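(* Let $X$ be a random vector in $\mathbb{R}^d$, $d \ge 1$. If $\mathbb{E} e^{u \cdot X} < \infty$ for every $u \in \mathbb{R}^d$, then the rate function $I_X$ is strictly convex.
   Context: The rate function of $X$ is $I_X(v) := \sup_{u \in \mathbb{R}^d} (u \cdot v - \log \mathbb{E} e^{u \cdot X}) \in [0, +\infty]$, $v \in \mathbb{R}^d$, and its effective domain is $\mathcal{D}(I_X) := \{v \in \mathbb{R}^d : I_X(v) < +\infty\}$. $I_X$ is called strictly convex if it is affine on no (non-degenerate) line segment contained in the whole effective domain $\mathcal{D}(I_X)$ (including segments in its relative boundary). *)

(* Defs.v *)
From HB Require Import structures.
From mathcomp Require Import all_boot all_order all_algebra.
From mathcomp Require Import all_classical all_reals all_analysis.

Set Implicit Arguments.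
Unset Strict Implicit.
Unset Printing Implicit Defensive.

Import Order.TTheory GRing.Theory Num.Theory.
Import numFieldNormedType.Exports.

Local Open Scope classical_set_scope.
Local Open Scope ring_scope.

Definition dot (R : realType) (d : nat) (u v : 'rV[R]_d) : R :=
  \sum_(i < d) u ord0 i * v ord0 i.

(* 'rV[R]_d carries no measurable structure in the library; coordinatewise
   measurability is measurability for the product (= Borel) sigma-algebra. *)
Definition random_vector (disp : measure_display) (T : measurableType disp)
    (R : realType) (d : nat) (X : T -> 'rV[R]_d) : Prop :=
  forall i : 'I_d, measurable_fun [set: T] (fun w => X w ord0 i).

(* Not bundled with a measurability proof: only meaningful when X is a random
   vector. *)
Definition mgf (disp : measure_display) (T : measurableType disp)
    (R : realType) (P : probability T R) (d : nat) (X : T -> 'rV[R]_d)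
    (u : 'rV[R]_d) : \bar R :=
  'E_P[fun w => expR (dot u (X w))]%E.

(* Where mgf P X u = +oo, lne returns +oo and the term in the supremum is -oo. *)
Definition rate_function (disp : measure_display) (T : measurableType disp)
    (R : realType) (P : probability T R) (d : nat) (X : T -> 'rV[R]_d)
    (v : 'rV[R]_d) : \bar R :=
  ereal_sup [set ((dot u v)%:E - lne (mgf P X u))%E | u in [set: 'rV[R]_d]].

Definition effective_domain (R : realType) (V : Type) (f : V -> \bar R) :
    set V :=
  [set v | (f v < +oo)%E].

Definition segment (R : realType) (V : lmodType R) (a b : V) : set V :=
  [set (1 - t) *: a + t *: b | t in `[0, 1]].

(* Meaningful for convex S on which f is finite. *)
Definition affine_on (R : realType) (V : lmodType R) (S : set V)
    (f : V -> \bar R) : Prop :=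
  forall (x y : V) (t : R), S x -> S y -> 0 <= t <= 1 ->
    f ((1 - t) *: x + t *: y) = ((1 - t)%:E * f x + t%:E * f y)%E.

(* Segments range over the whole effective domain, including its relative
   boundary; this is stronger than strict convexity on the relative interior. *)
Definition strictly_convex (R : realType) (V : lmodType R)
    (f : V -> \bar R) : Prop :=
  forall a b : V, a != b -> segment a b `<=` effective_domain f ->
    ~ affine_on (segment a b) f.

(* Main.v *)
(* Suppose that [I_X] is affine on [[a, b]], let [m] be the midpoint,
   [e = (b - a) / 2] and [phi u = E exp (u . (X - m))], so that
   [J := exp (- I_X m)] is the infimum of [phi].  It need not be attained when
   [m] is on the relative boundary of the domain, so one perturbs an arbitrary
   almost minimizer [u], moving to [(1 - t) u +- t s e].  Bounding the two
   moment generating functions from below by the rate function at [a] and [b]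
   and applying AM-GM with [I_X m = (I_X a + I_X b) / 2] gives an average of at
   least [J exp (t s |e|^2)], while a pointwise inequality between exponentials
   bounds it above by [phi u + t + C t^2], where [C] depends on [s] but not on
   [u].  Letting [phi u] tend to [J], then [t] to [0], yields
   [J s |e|^2 <= 1] for all [s], which is absurd. *)

Require Import Defs.
From HB Require Import structures.
From mathcomp Require Import all_boot all_order all_algebra.
From mathcomp Require Import all_classical all_reals all_analysis.
From mathcomp Require Import measurable_realfun ring lra.

Set Implicit Arguments.
Unset Strict Implicit.
Unset Printing Implicit Defensive.

Import Order.TTheory GRing.Theory Num.Theory.

Local Open Scope classical_set_scope.
Local Open Scope ring_scope.

(** * Bilinearity and positivity of the dot product *)

Section Dot.
Context {R : realType} {d : nat}.
Implicit Types (u v w : 'rV[R]_d) (k : R).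

Lemma dotDl u v w : dot (u + v) w = dot u w + dot v w.
Proof. by rewrite /dot -big_split; apply: eq_bigr => i _; rewrite mxE mulrDl. Qed.

Lemma dotZl k u v : dot (k *: u) v = k * dot u v.
Proof. by rewrite /dot mulr_sumr; apply: eq_bigr => i _; rewrite mxE mulrA. Qed.

Lemma dotC u v : dot u v = dot v u.
Proof. by apply: eq_bigr => i _; rewrite mulrC. Qed.

Lemma dotDr u v w : dot u (v + w) = dot u v + dot u w.
Proof. by rewrite dotC dotDl !(dotC u). Qed.

Lemma dotZr k u v : dot u (k *: v) = k * dot u v.
Proof. by rewrite dotC dotZl dotC. Qed.

Lemma dotNl u v : dot (- u) v = - dot u v.
Proof. by rewrite -scaleN1r dotZl mulN1r. Qed.

Lemma dotNr u v : dot u (- v) = - dot u v.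
Proof. by rewrite -scaleN1r dotZr mulN1r. Qed.

Lemma dotBr u v w : dot u (v - w) = dot u v - dot u w.
Proof. by rewrite dotDr dotNr. Qed.

Lemma dot_gt0 u : u != 0 -> 0 < dot u u.
Proof.
move=> /rV0Pn[i ui]; rewrite /dot (bigD1 i)//= ltr_pwDl//.
  by rewrite -expr2 exprn_even_gt0.
by apply: sumr_ge0 => j _; rewrite -expr2 sqr_ge0.
Qed.

End Dot.

(** * Elementary inequalities for the exponential *)

Section ExpInequalities.
Context {R : realType}.
Implicit Types x y t p : R.

Lemma expR_scale_le t x : 0 <= t <= 1 -> expR (t * x) <= 1 - t + t * expR x.
Proof.
move=> /andP[t0 t1].
(* After division by [expR (t * x)] the two exponents have weighted mean zero, so averaging the
   tangent bound at zero suffices. *)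
suff h : 1 <= (1 - t) * expR (- (t * x)) + t * expR ((1 - t) * x).
  have := ler_wpM2l (expR_ge0 (t * x)) h.
  by rewrite mulr1 mulrDr !(mulrCA (expR _)) -!expRD subrr expR0 mulr1
    -mulrDl subrKC mul1r.
have h1 : 1 + (1 - t) * x <= expR ((1 - t) * x) by exact: expR_ge1Dx.
have h2 : 1 + - (t * x) <= expR (- (t * x)) by exact: expR_ge1Dx.
have := ler_wpM2l t0 h1.
have t1' : 0 <= 1 - t by lra.
have := ler_wpM2l t1' h2.
lra.
Qed.

Lemma expR_midpoint_le x y : expR ((x + y) / 2) <= (expR x + expR y) / 2.
Proof.
have hx : expR x = expR (x / 2) ^+ 2 by rewrite -expRM_natl; congr expR; field.
have hy : expR y = expR (y / 2) ^+ 2 by rewrite -expRM_natl; congr expR; field.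
rewrite hx hy mulrDl expRD.
have := sqr_ge0 (expR (x / 2) - expR (y / 2)); nra.
Qed.

(* The error is [t + O(t^2)] with coefficients independent
   of [p].  When [|y| <= p], both exponents on the left are at most [p]; when
   [p < |y|], the factor [expR ((1 - t) * p)] of [cosh (t * y) - 1 = O(t^2)]
   is absorbed in [expR `|y|]. *)
Lemma expR_perturbation t p y : 0 <= t <= 1 ->
  (expR ((1 - t) * p + t * y) + expR ((1 - t) * p - t * y)) / 2 <=
  expR p + t + t ^+ 2 * (expR (3 * y) + expR (- (3 * y))).
Proof.
wlog y0 : y / 0 <= y => [hw|].
  move=> t01; have [/hw|y0] := leP 0 y; first exact.
  have := hw (- y) _ t01; rewrite oppr_ge0 => /(_ (ltW y0)).
  by rewrite !mulrN !opprK; lra.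
move=> t01; have /andP[t0 t1] := t01.
have e3 : 0 <= expR (- (3 * y)) by exact: expR_ge0.
have e3' : 0 <= expR (3 * y) by exact: expR_ge0.
have [yp|py] := leP y p.
  have h1 : expR ((1 - t) * p + t * y) <= expR p by rewrite ler_expR; nra.
  have h2 : expR ((1 - t) * p - t * y) <= expR p by rewrite ler_expR; nra.
  have := mulr_ge0 (sqr_ge0 t) (addr_ge0 e3' e3); lra.
(* Convexity with weight [1 - t]; the linear error [t] matters when [p] is negative. *)
have h1 : expR ((1 - t) * p) <= expR p + t.
  have t01' : 0 <= 1 - t <= 1 by lra.
  have := expR_scale_le p t01'; have := expR_ge0 p; nra.
have h2 : expR ((1 - t) * p) <= expR y by rewrite ler_expR; nra.
set E := expR ((1 - t) * p) in h1 h2 *.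
have E0 : 0 <= E by exact: expR_ge0.
pose z := expR (t * y); pose z' := expR (- (t * y)).
have zz' : z * z' = 1 by rewrite -expRD subrr expR0.
have z1 : 1 <= z by rewrite -expR0 ler_expR; nra.
have z'0 : 0 <= z' by exact: expR_ge0.
have z'1 : z' <= 1 by rewrite -expR0 ler_expR; nra.
have zle : z - 1 <= t * expR y.
  by have := expR_scale_le y t01; rewrite -/z; lra.
(* As [z * z' = 1], the excess is quadratic in [z - 1], which is at most [t * expR y]. *)
have coshE : (z + z') / 2 - 1 = z' * (z - 1) ^+ 2 / 2.
  have -> : z' * (z - 1) ^+ 2 = z * (z * z') - 2 * (z * z') + z' by ring.
  by rewrite zz'; field.
have hc : (z + z') / 2 - 1 <= t ^+ 2 * expR y ^+ 2.
  have h : (z - 1) ^+ 2 <= t ^+ 2 * expR y ^+ 2.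
    rewrite -exprMn; have h0 : 0 <= z - 1 by lra.
    by apply: lerXn2r; rewrite ?nnegrE ?(le_trans h0 zle).
  by rewrite coshE; have := sqr_ge0 (z - 1); nra.
have c0 : 0 <= (z + z') / 2 - 1.
  by rewrite coshE; have := mulr_ge0 z'0 (sqr_ge0 (z - 1)); lra.
rewrite !expRD -/E -/z -/z'.
(* One factor [expR y] bounds [E], the other two come from [hc]. *)
have -> : expR (3 * y) = expR y * expR y ^+ 2 by rewrite expRM_natl exprS.
have := ler_pM E0 c0 h2 hc.
have := mulr_ge0 (sqr_ge0 t) e3.
lra.
Qed.

End ExpInequalities.

(** * Moment generating function of [X - v] *)

Section CenteredMgf.
Context {disp : measure_display} {T : measurableType disp} {R : realType}.
Context {d : nat}.
Context (P : probability T R) (X : T -> 'rV[R]_d) (hX : random_vector X).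
Context (hmgf : forall u : 'rV[R]_d, (mgf P X u < +oo)%E).

Local Notation phi v u := (\int[P]_w expR (dot u (X w - v))).

Lemma integrable_expR_dot u v :
  P.-integrable [set: T] (EFin \o (fun w => expR (dot u (X w - v)))).
Proof.
have me c : measurable_fun [set: T] (fun w => expR (dot u (X w) - c)).
  apply: measurableT_comp => //; apply: measurable_funB => //.
  by apply: measurable_sum => i; apply: measurable_funM.
have i0 : P.-integrable [set: T] (EFin \o (fun w => expR (dot u (X w)))).
  apply/integrableP; split.
    apply/measurable_EFinP; have := me 0; congr measurable_fun.
    by apply/funext => w; rewrite subr0.
  have := hmgf u; rewrite /mgf unlock; congr (_ < _)%E.
  by apply: eq_integral => w _ /=; rewrite ger0_norm// expR_ge0.
have := integrableZl measurableT (expR (- dot u v)) i0.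
congr integrable; apply/funext => w /=.
by rewrite -EFinM -expRD dotBr addrC.
Qed.

Lemma mgfE u : mgf P X u = (phi 0 u)%:E.
Proof.
rewrite /Rintegral fineK; last exact: integrable_fin_num (integrable_expR_dot u 0).
by rewrite /mgf unlock; apply: eq_integral => w _; rewrite subr0.
Qed.

(** Allows the bounds at both endpoints to be stated through the one function centered at the
    midpoint. *)
Lemma centered_mgf_shift v v' u :
  phi v' u = phi v u * expR (dot u (v - v')).
Proof.
rewrite mulrC -RintegralZl//; last exact: integrable_expR_dot.
by apply: eq_Rintegral => w _; rewrite -expRD !dotBr; congr expR; ring.
Qed.

Lemma centered_mgf_ge0 v u : 0 <= phi v u.
Proof. by apply: Rintegral_ge0 => w _; exact: expR_ge0. Qed.

(** Negating and exponentiating turns the supremum defining the rate function into an infimum of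
    [phi v], possibly not attained. *)
Lemma rate_function_centered_mgf v r : rate_function P X v = r%:E ->
  (forall u, expR (- r) <= phi v u) /\
  (forall e, 0 < e -> exists u, phi v u < expR (e - r)).
Proof.
move=> rE.
have le_r u : ((dot u v)%:E - lne (mgf P X u) <= r%:E)%E.
  by rewrite -rE; apply: ereal_sup_ubound; exists u.
(* Otherwise [lne] would be [-oo] and the supremum [+oo], against [rE]. *)
have phi_gt0 u : 0 < phi 0 u.
  rewrite ltNge; apply/negP => phi_le0; have := le_r u.
  by rewrite mgfE le0_lneNy.
have phiE u : phi v u = expR (ln (phi 0 u) - dot u v).
  rewrite (centered_mgf_shift 0) expRD lnK ?posrE//.
  by rewrite sub0r dotNr.
split=> [u|e e0].
  have := le_r u; rewrite mgfE lne_EFin// -EFinB lee_fin phiE ler_expR; lra.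
have : rate_function P X v \is a fin_num by rewrite rE.
move=> /(ub_ereal_sup_adherent e0)[_ [u _ <-]].
rewrite -/(rate_function P X v) rE mgfE lne_EFin// -!EFinB lte_fin => h.
by exists u; rewrite phiE ltr_expR; lra.
Qed.

(** Integrates [expR_perturbation] pointwise; the constant [t] survives since [P] has mass one. *)
Lemma centered_mgf_perturbation v u y t : 0 <= t <= 1 ->
  (phi v ((1 - t) *: u + t *: y) + phi v ((1 - t) *: u - t *: y)) / 2 <=
  phi v u + t + t ^+ 2 * (phi v (3 *: y) + phi v (- (3 *: y))).
Proof.
move=> t01.
have I u' := integrable_expR_dot u' v.
have ID f g : P.-integrable setT (EFin \o f) -> P.-integrable setT (EFin \o g) ->
    P.-integrable setT (EFin \o (fun w => f w + g w : R)).
  by move=> If Ig; exact: (integrableD measurableT If Ig).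
have IZ k f : P.-integrable setT (EFin \o f) ->
    P.-integrable setT (EFin \o (fun w => k * f w : R)).
  by move=> If; exact: (integrableZl measurableT k If).
have I1 : P.-integrable setT (EFin \o (fun=> t)).
  exact: finite_measure_integrable_cst.
have P1 : \int[P]_w t = t.
  by rewrite Rintegral_cst//= probability_setT/= mulr1.
pose F u' w := expR (dot u' (X w - v)).
have IDF u1 u2 : P.-integrable setT (EFin \o (fun w => F u1 w + F u2 w)).
  exact: (ID _ _ (I u1) (I u2)).
have IL u1 u2 k := IZ k _ (IDF u1 u2).
have IR := ID _ _ (I u) I1.
have EL u1 u2 : (phi v u1 + phi v u2) / 2 = \int[P]_w (2^-1 * (F u1 w + F u2 w)).
  rewrite (RintegralZl _ measurableT (IDF u1 u2)).
  by rewrite (RintegralD measurableT (I u1) (I u2)) mulrC.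
have ER u1 u2 : phi v u + t + t ^+ 2 * (phi v u1 + phi v u2) =
    \int[P]_w (F u w + t + t ^+ 2 * (F u1 w + F u2 w)).
  rewrite (RintegralD measurableT IR (IL u1 u2 (t ^+ 2))).
  rewrite (RintegralD measurableT (I u) I1) P1.
  rewrite (RintegralZl _ measurableT (IDF u1 u2)).
  by rewrite (RintegralD measurableT (I u1) (I u2)).
rewrite EL ER.
apply: (le_Rintegral measurableT (IL _ _ _) (ID _ _ IR (IL _ _ _))).
move=> w _; have := expR_perturbation (dot u (X w - v)) (dot y (X w - v)) t01.
by rewrite /F !dotDl !dotNl !dotZl [_ / 2]mulrC.
Qed.

End CenteredMgf.

(** * Non-negativity and strict convexity of the rate function *)

Lemma rate_function_ge0 (R : realType) (d : nat)
    (disp : measure_display) (T : measurableType disp) (P : probability T R)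
    (X : T -> 'rV[R]_d) v : (0 <= rate_function P X v)%E.
Proof.
apply: ereal_sup_ubound; exists 0 => //.
have dot0 w : dot 0 w = 0 :> R by rewrite -(scale0r 0) dotZl mul0r.
rewrite dot0 /mgf (_ : (fun w => _) = cst 1) ?expectation_cst ?lne1 ?sube0//.
by apply/funext => w; rewrite dot0 expR0.
Qed.

Theorem corollary1 (R : realType) (d : nat) (hd : (1 <= d)%N)
    (disp : measure_display) (T : measurableType disp) (P : probability T R)
    (X : T -> 'rV[R]_d) (hX : random_vector X)
    (hmgf : forall u : 'rV[R]_d, (mgf P X u < +oo)%E) :
  strictly_convex (rate_function P X).
Proof.
move=> a b ab sub_dom aff.
have half01 : 0 <= (2^-1 : R) <= 1 by lra.
have fin v : segment a b v -> exists r, rate_function P X v = r%:E.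
  move=> /sub_dom; rewrite /effective_domain/=; have := rate_function_ge0 P X v.
  by case: rate_function => // r _ _; exists r.
have sa : segment a b a.
  by exists 0; rewrite ?subr0 ?scale1r ?scale0r ?addr0//= in_itv/= lexx ler01.
have sb : segment a b b.
  by exists 1; rewrite ?subrr ?scale1r ?scale0r ?add0r//= in_itv/= lexx ler01.
have [ra raE] := fin a sa.
have [rb rbE] := fin b sb.
pose m : 'rV[R]_d := (1 - 2^-1) *: a + 2^-1 *: b.
pose rm := (1 - 2^-1) * ra + 2^-1 * rb.
have rmE : rate_function P X m = rm%:E.
  by rewrite (aff _ _ _ sa sb half01) raE rbE -!EFinM -EFinD.
pose e := 2^-1 *: (b - a).
have mb : m - b = - e.
  by apply/rowP => i; rewrite !mxE; field.
have ma : m - a = e.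
  by apply/rowP => i; rewrite !mxE; field.
have k0 : 0 < dot e e.
  by apply: dot_gt0; rewrite scaler_eq0 invr_eq0 pnatr_eq0/= subr_eq0 eq_sym.
clearbody e.
set k := dot e e in k0.
pose phi u := \int[P]_w expR (dot u (X w - m)).
have le_a u : expR (- ra) <= phi u * expR (dot u e).
  have [/(_ u) + _] := rate_function_centered_mgf hX hmgf raE.
  by rewrite (centered_mgf_shift hX hmgf m) ma.
have le_b u : expR (- rb) <= phi u * expR (- dot u e).
  have [/(_ u) + _] := rate_function_centered_mgf hX hmgf rbE.
  by rewrite (centered_mgf_shift hX hmgf m) mb dotNr.
have near_m x : 0 < x -> exists u, phi u < expR (x - rm).
  by have [_] := rate_function_centered_mgf hX hmgf rmE; exact.
have phi_ge0 u : 0 <= phi u by exact: centered_mgf_ge0.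
have perturb u y t : 0 <= t <= 1 ->
    (phi ((1 - t) *: u + t *: y) + phi ((1 - t) *: u - t *: y)) / 2 <=
    phi u + t + t ^+ 2 * (phi (3 *: y) + phi (- (3 *: y))).
  exact: centered_mgf_perturbation.
clearbody phi.
pose J := expR (- rm); have J0 : 0 < J by exact: expR_gt0.
(* Chosen so that [J * x = 2 * t] below, beating the error [t + t ^+ 2 * C]; [C] is fixed before [t]
   and [u]. *)
pose s := 4 / (J * k).
pose C := phi (3 *: (s *: e)) + phi (- (3 *: (s *: e))).
have C0 : 0 <= C by exact: addr_ge0.
pose t := (2 * (1 + C))^-1.
have t0 : 0 < t by rewrite invr_gt0; lra.
have tC : 2 * t * (1 + C) = 1.
  by rewrite /t; field; lra.
have t01 : 0 <= t <= 1 by apply/andP; split; nra.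
(* Half of the gain [t * s * k] in the exponent; the other half pays for [u] being only an almost
   minimizer. *)
pose x := t * s * k / 2.
have Jx : J * x = 2 * t.
  by rewrite /x /s; field; rewrite !gt_eqF.
have x0 : 0 < x by rewrite -(pmulr_rgt0 _ J0) Jx; lra.
have xE : 2 * x = t * (s * k) by rewrite /x; field.
clearbody x t s.
have [u] := near_m x x0 => phi_u.
have lower : J * expR (2 * x) <=
    (phi ((1 - t) *: u + t *: (s *: e)) + phi ((1 - t) *: u - t *: (s *: e))) / 2.
  pose up := (1 - t) *: u + t *: (s *: e).
  pose um := (1 - t) *: u - t *: (s *: e).
  rewrite -/up -/um.
  have upE : dot up e = (1 - t) * dot u e + 2 * x.
    by rewrite /up dotDl !dotZl -/k xE.
  have umE : dot um e = (1 - t) * dot u e - 2 * x.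
    by rewrite /um dotDl dotNl !dotZl -/k xE.
  have hb : expR (- rb + dot up e) <= phi up.
    have := le_b up; rewrite (expRN (dot up e)).
    by rewrite ler_pdivlMr ?expR_gt0// expRD.
  have ha : expR (- ra - dot um e) <= phi um.
    by rewrite expRD (expRN (dot um e)) ler_pdivrMr ?expR_gt0.
  (* The terms [(1 - t) * dot u e] cancel in the mean, so the bound does not depend on [u]. *)
  have := expR_midpoint_le (- rb + dot up e) (- ra - dot um e).
  rewrite upE umE in ha hb *.
  have -> : (- rb + ((1 - t) * dot u e + 2 * x) +
      (- ra - ((1 - t) * dot u e - 2 * x))) / 2 = - rm + 2 * x.
    by rewrite /rm; field.
  rewrite (expRD (- rm)) -/J => /le_trans; apply.
  by rewrite ler_pM2r ?invr_gt0 ?ltr0n// lerD.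
have upper := le_trans lower (perturb u (s *: e) t t01).
rewrite -/C in upper.
have ex : 1 + x <= expR x by exact: expR_ge1Dx.
have e2x : expR (2 * x) = expR x ^+ 2 by rewrite expRM_natl.
rewrite addrC expRD -/J in phi_u.
have gap : J * x <= J * expR (2 * x) - J * expR x.
  by rewrite e2x -mulrBr ler_pM2l//; nra.
(* Altogether [2 * t = J * x < t + t ^+ 2 * C <= 3 * t / 2], a contradiction. *)
have tC2 : t * C <= 2^-1 by lra.
have := ler_wpM2l (ltW t0) tC2; lra.
Qed.
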